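(* (Linear ISS small-gain theorem in semi-maximum formulation.) Let $I$ be an arbitrary nonempty index set, let $(X_i,\|\cdot\|_{X_i})$, $i\in I$, be normed spaces and let $\Sigma_i=(X_i,\mathrm{PC}_b(\mathbb{R}_+,X_{\neq i})\times\mathcal{U},\bar\phi_i)$, $i\in I$, be forward complete control systems. Assume that the interconnection $\Sigma=(X,\mathcal{U},\phi)$ of the systems $\Sigma_i$ is well-defined. Furthermore, assume: (i) Each system $\Sigma_i$ is ISS in semi-maximum formulation, with $\beta_i\in\mathcal{KL}$ and gains $\gamma_{ij},\gamma_i\in\mathcal{K}\cup\{0\}$ ($j\in I$). (ii) There are $\beta_{\max}\in\mathcal{KL}$ and $\gamma_{\max}\in\mathcal{K}$ such that $\beta_i\le\beta_{\max}$ and $\gamma_i\le\gamma_{\max}$ pointwise for all $i\in I$. (iii) All gains $\gamma_{ij}$, $i,j\in I$, are linear functions (and are identified with nonnegative real numbers $\gamma_{ij}$), the operator $\Gamma_\otimes:\ell_\infty(I)^+\to\ell_\infty(I)^+$, $\Gamma_\otimes(s):=(\sup_{j\in I}\gamma_{ij}s_j)_{i\in I}$, is well-defined, and $$\lim_{n\to\infty}\Bigl(\sup_{j_1,\ldots,j_{n+1}\in I}\gamma_{j_1j_2}\cdots\gamma_{j_nj_{n+1}}\Bigr)^{1/n}<1.$$ Then $\Sigma$ is ISS.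
   Context: **Comparison functions.** $\mathcal{K}$: continuous strictly increasing $\gamma:\mathbb{R}_+\to\mathbb{R}_+$ with $\gamma(0)=0$. $\mathcal{L}$: continuous strictly decreasing $\gamma:\mathbb{R}_+\to\mathbb{R}_+$ with $\gamma(t)\to0$ as $t\to\infty$. $\mathcal{KL}$: continuous $\beta:\mathbb{R}_+^2\to\mathbb{R}_+$ with $\beta(\cdot,t)\in\mathcal{K}$ for all $t\ge0$ and $\beta(r,\cdot)\in\mathcal{L}$ for all $r>0$. In $\mathcal{K}\cup\{0\}$, $0$ is the zero function. **Sequence spaces.** $\ell_\infty(I)$ is the Banach space of bounded functions $x:I\to\mathbb{R}$ with the sup-norm; $\ell_\infty(I)^+$ is the cone of its componentwise nonnegative elements. $\Gamma_\otimes$ is well-defined (maps $\ell_\infty(I)^+$ to itself) if and only if $\sup_{i,j\in I}\gamma_{ij}(r)<\infty$ for every $r>0$. For $w:J\to W$ bounded, $J\subset\mathbb{R}_+$ nonempty, $W$ normed, $\|w\|_J:=\sup_{s\in J}\|w(s)\|_W$. **Control systems.** A control system is a triple $\Sigma=(X,\mathcal{U},\phi)$ with: a normed space $(X,\|\cdot\|_X)$ (state space); a vector space $U$ of input values and a normed space of inputs $(\mathcal{U},\|\cdot\|_{\mathcal{U}})$, $\mathcal{U}$ a linear subspace of $U^{\mathbb{R}_+}$ (all maps $\mathbb{R}_+\to U$), satisfying shift invariance (for all $u\in\mathcal{U}$, $\tau\ge0$: $u(\cdot+\tau)\in\mathcal{U}$ and $\|u\|_{\mathcal{U}}\ge\|u(\cdot+\tau)\|_{\mathcal{U}}$)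 and concatenation (for all $u_1,u_2\in\mathcal{U}$, $t>0$, the function equal to $u_1(\tau)$ for $\tau\in[0,t]$ and $u_2(\tau-t)$ for $\tau>t$ is in $\mathcal{U}$); a transition map $\phi:D_\phi\to X$, $D_\phi\subseteq\mathbb{R}_+\times X\times\mathcal{U}$, such that for all $(x,u)$ one has $D_\phi\cap(\mathbb{R}_+\times\{(x,u)\})=[0,t_m)\times\{(x,u)\}$ for some $t_m=t_m(x,u)\in(0,\infty]$. The following axioms are required: $\phi(0,x,u)=x$; causality (if $(t,x,u)\in D_\phi$ and $\tilde u\in\mathcal{U}$ agrees with $u$ on $[0,t]$, then $[0,t]\times\{(x,\tilde u)\}\subset D_\phi$ and $\phi(t,x,u)=\phi(t,x,\tilde u)$); continuity of $t\mapsto\phi(t,x,u)$ on $[0,t_m(x,u))$; cocycle property (if $[0,t+h]\times\{(x,u)\}\subset D_\phi$, $t,h\ge 0$, then $\phi(h,\phi(t,x,u),u(t+\cdot))=\phi(t+h,x,u)$). $\Sigma$ is forward complete if $D_\phi=\mathbb{R}_+\times X\times\mathcal{U}$. $\Sigma$ has the boundedness-implies-continuation (BIC) property if for each $(x,u)$ with $t_m(x,u)<\infty$ and each $M>0$ there is $t\in[0,t_m)$ with $\|\phi(t,x,u)\|_X>M$. **ISS.** $\Sigma$ is input-to-state stable (ISS) if there are $\beta\in\mathcal{KL}$, $\gamma\in\mathcal{K}\cup\{0\}$ with $\|\phi(t,x,u)\|_X\le\beta(\|x\|_X,t)+\gamma(\|u\|_{\mathcal{U}})$ for all $(t,x,u)\in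 D_\phi$. **Interconnections.** Given normed spaces $X_i$, $i\in I$, put $X:=\{(x_i)_{i\in I}\in\prod_i X_i:\sup_i\|x_i\|_{X_i}<\infty\}$ with $\|x\|_X:=\sup_i\|x_i\|_{X_i}$, and let $X_{\neq i}$ be the same construction for the index set $I\setminus\{i\}$. $\mathrm{PC}_b(\mathbb{R}_+,X_{\neq i})$ is the space of globally bounded piecewise continuous functions $w:\mathbb{R}_+\to X_{\neq i}$ with sup-norm $\|w\|_\infty$. $\mathcal{U}$ is a fixed normed space of inputs (satisfying shift invariance and concatenation), common to all subsystems, and $\mathrm{PC}_b(\mathbb{R}_+,X_{\neq i})\times\mathcal{U}$ has norm $\max\{\|w\|_\infty,\|u\|_{\mathcal{U}}\}$. Given control systems $\Sigma_i=(X_i,\mathrm{PC}_b(\mathbb{R}_+,X_{\neq i})\times\mathcal{U},\bar\phi_i)$, consider maps $\phi:D_\phi\to X$, $D_\phi\subset\mathbb{R}_+\times X\times\mathcal{U}$, such that (1) for each $(x,u)\in X\times\mathcal{U}$ there is $\varepsilon>0$ with $[0,\varepsilon]\times\{(x,u)\}\subset D_\phi$; (2) the components satisfy $\phi_i(t,x,u)=\bar\phi_i(t,x_i,(\phi_{\neq i},u))$ for all $(t,x,u)\in D_\phi$, $i\in I$, where $\phi_{\neq i}(\cdot)=(\phi_j(\cdot,x,u))_{j\in I\setminus\{i\}}$ (by causality only the values of $\phi_{\neq i}$ on $[0,t]$ matter, so it can be regarded as globally bounded); and $\phi$ is maximal, i.e. no proper extension of $\phi$ satisfies these properties. If the map $\phi$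 with these properties is unique and $\Sigma=(X,\mathcal{U},\phi)$ is a control system satisfying the BIC property, then $\Sigma$ is called the (well-defined) interconnection of the $\Sigma_i$. **ISS of $\Sigma_i$ in semi-maximum formulation.** $\Sigma_i$ is forward complete and there are $\beta_i\in\mathcal{KL}$ and $\gamma_{ij},\gamma_i\in\mathcal{K}\cup\{0\}$ ($j\in I$) such that for all $x_i\in X_i$, $w_{\neq i}=(w_j)_{j\in I\setminus\{i\}}\in\mathrm{PC}_b(\mathbb{R}_+,X_{\neq i})$, $u\in\mathcal{U}$, $t\ge0$: $\|\bar\phi_i(t,x_i,(w_{\neq i},u))\|_{X_i}\le\beta_i(\|x_i\|_{X_i},t)+\sup_{j\in I}\gamma_{ij}(\|w_j\|_{[0,t]})+\gamma_i(\|u\|_{\mathcal{U}})$, where $\sup_{j\in I}\gamma_{ij}(r)<\infty$ for every $r\ge0$ and $\gamma_{ii}=0$ (so the term $j=i$ is $0$). *)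

(* Defs.v *)
From HB Require Import structures.
From mathcomp Require Import all_boot all_order all_algebra.
From mathcomp Require Import all_classical all_reals all_analysis.

Set Implicit Arguments.
Unset Strict Implicit.
Unset Printing Implicit Defensive.

Import Order.TTheory GRing.Theory Num.Theory.
Import numFieldNormedType.Exports.

Local Open Scope classical_set_scope.
Local Open Scope ring_scope.

(** * Comparison functions *)

(* Comparison functions are maps on R; only their values on [0, +oo[ matter. *)
Section comparison_functions.
Context {R : realType}.

Definition class_K (g : R -> R) : Prop :=
  [/\ {within `[0, +oo[, continuous g},
      (forall r s, 0 <= r -> r < s -> g r < g s) & g 0 = 0].

Definition class_K0 (g : R -> R) : Prop :=
  class_K g \/ (forall r, 0 <= r -> g r = 0).

Definition class_L (g : R -> R) : Prop :=
  [/\ {within `[0, +oo[, continuous g},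
      (forall t, 0 <= t -> 0 <= g t),
      (forall s t, 0 <= s -> s < t -> g t < g s) &
      g t @[t --> +oo] --> (0 : R)].

Definition class_KL (b : R -> R -> R) : Prop :=
  [/\ {within `[0, +oo[ `*` `[0, +oo[, continuous (fun p : R * R => b p.1 p.2)},
      (forall t, 0 <= t -> class_K (b ^~ t)) &
      (forall r, 0 < r -> class_L (b r))].

End comparison_functions.

(** * Bounded families with the sup-norm *)

Section bounded_families.
Context {R : realType} {I : Type} (X : I -> normedModType R).

Definition bounded_family (x : forall i, X i) : Prop :=
  exists M : R, forall i, `|x i| <= M.

Record linf_sum := LinfSum {
  linf_fun :> forall i, X i;
  linf_bounded : bounded_family linf_fun }.

Lemma linf_eq (x y : linf_sum) : (forall i, x i = y i) -> x = y.
Proof.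
case: x y => [x xb] [y yb] /= xy.
have {}xy : x = y by apply: functional_extensionality_dep.
by subst y; congr LinfSum; exact: Prop_irrelevance.
Qed.

HB.instance Definition _ := gen_eqMixin linf_sum.
HB.instance Definition _ := gen_choiceMixin linf_sum.

Fact linf_zero_subproof : bounded_family (fun i => 0 : X i).
Proof. by exists 0 => i; rewrite normr0. Qed.
Fact linf_opp_subproof (x : linf_sum) : bounded_family (fun i => - x i).
Proof. by have [M xM] := linf_bounded x; exists M => i; rewrite normrN. Qed.
Fact linf_add_subproof (x y : linf_sum) : bounded_family (fun i => x i + y i).
Proof.
have [M xM] := linf_bounded x; have [N yN] := linf_bounded y.
by exists (M + N) => i; rewrite (le_trans (ler_normD _ _))// lerD ?xM ?yN.
Qed.
Fact linf_scale_subproof (a : R) (x : linf_sum) :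
  bounded_family (fun i => a *: x i).
Proof.
by have [M xM] := linf_bounded x; exists (`|a| * M) => i; rewrite normrZ ler_wpM2l ?xM.
Qed.

Definition linf_zero := LinfSum linf_zero_subproof.
Definition linf_opp x := LinfSum (linf_opp_subproof x).
Definition linf_add x y := LinfSum (linf_add_subproof x y).
Definition linf_scale a x := LinfSum (linf_scale_subproof a x).

Fact linf_addA : associative linf_add.
Proof. by move=> x y z; apply: linf_eq => i /=; rewrite addrA. Qed.
Fact linf_addC : commutative linf_add.
Proof. by move=> x y; apply: linf_eq => i /=; rewrite addrC. Qed.
Fact linf_add0 : left_id linf_zero linf_add.
Proof. by move=> x; apply: linf_eq => i /=; rewrite add0r. Qed.
Fact linf_addN : left_inverse linf_zero linf_opp linf_add.
Proof. by move=> x; apply: linf_eq => i /=; rewrite addNr. Qed.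

HB.instance Definition _ :=
  GRing.isZmodule.Build linf_sum linf_addA linf_addC linf_add0 linf_addN.

Fact linf_scaleA a b x : linf_scale a (linf_scale b x) = linf_scale (a * b) x.
Proof. by apply: linf_eq => i /=; rewrite scalerA. Qed.
Fact linf_scale1 : left_id 1 linf_scale.
Proof. by move=> x; apply: linf_eq => i /=; rewrite scale1r. Qed.
Fact linf_scaleDr : right_distributive linf_scale +%R.
Proof. by move=> a x y; apply: linf_eq => i /=; rewrite scalerDr. Qed.
Fact linf_scaleDl x : {morph linf_scale^~ x : a b / a + b}.
Proof. by move=> a b; apply: linf_eq => i /=; rewrite scalerDl. Qed.

HB.instance Definition _ := GRing.Zmodule_isLmodule.Build R linf_sum
  linf_scaleA linf_scale1 linf_scaleDr linf_scaleDl.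

(* For an empty I this is sup set0 = 0, the norm of the zero space. *)
Definition linf_norm (x : linf_sum) : R := sup [set `|x i| | i in [set: I]].

Lemma linf_norm_ub (x : linf_sum) i : `|x i| <= linf_norm x.
Proof.
have [M xM] := linf_bounded x; apply: ub_le_sup; last by exists i.
by exists M => _ [j _ <-].
Qed.

Lemma linf_norm_le (x : linf_sum) (M : R) :
  0 <= M -> (forall i, `|x i| <= M) -> linf_norm x <= M.
Proof.
move=> M0 xM; rewrite /linf_norm.
have [->|/set0P S0] := eqVneq [set `|x i| | i in [set: I]] set0.
  by rewrite sup0.
by apply: ge_sup => // _ [j _ <-].
Qed.

Lemma linf_norm_ge0 (x : linf_sum) : 0 <= linf_norm x.
Proof.
rewrite /linf_norm.
have [->|/set0P[_ [i _ _]]] := eqVneq [set `|x i| | i in [set: I]] set0.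
  by rewrite sup0.
exact: le_trans (normr_ge0 _) (linf_norm_ub x i).
Qed.

Fact linf_normD x y : linf_norm (x + y) <= linf_norm x + linf_norm y.
Proof.
apply: linf_norm_le => [|i]; first by rewrite addr_ge0// linf_norm_ge0.
by rewrite (le_trans (ler_normD _ _))// lerD// linf_norm_ub.
Qed.

Fact linf_normZ (a : R) x : linf_norm (a *: x) = `|a| * linf_norm x.
Proof.
have le b y : linf_norm (b *: y) <= `|b| * linf_norm y.
  apply: linf_norm_le => [|i]; first by rewrite mulr_ge0// linf_norm_ge0.
  by rewrite normrZ ler_wpM2l// linf_norm_ub.
apply/eqP; rewrite eq_le le /=.
have [->|a0] := eqVneq a 0; first by rewrite normr0 mul0r linf_norm_ge0.
rewrite -ler_pdivlMl ?normr_gt0// -normfV.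
by rewrite -[in leLHS](scalerK a0 x) le.
Qed.

Fact linf_norm0_eq0 x : linf_norm x = 0 -> x = 0.
Proof.
move=> x0; apply: linf_eq => i; apply/eqP; rewrite -normr_le0 -x0.
exact: linf_norm_ub.
Qed.

HB.instance Definition _ := Lmodule_isNormed.Build R linf_sum
  linf_normD linf_normZ linf_norm0_eq0.

End bounded_families.

(* The space X_{<> i}, indexed by I \ {i}. *)
Definition linf_except {R : realType} {I : Type} (X : I -> normedModType R)
  (i : I) := @linf_sum R {j : I | j <> i} (fun j => X (sval j)).

Section linf_restrict.
Context {R : realType} {I : Type} (X : I -> normedModType R).

Fact linf_restrict_subproof i (x : linf_sum X) :
  bounded_family (fun j : {j : I | j <> i} => x (sval j)).
Proof. by have [M xM] := linf_bounded x; exists M => j. Qed.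

Definition linf_restrict i (x : linf_sum X) : linf_except X i :=
  LinfSum (linf_restrict_subproof i x).

End linf_restrict.

(** * Functions of time *)

Section time.
Context {R : realType}.

Fact nneg_part_subproof (s : R) : 0 <= Num.max s 0.
Proof. by rewrite le_max lexx orbT. Qed.

Definition nneg_part (s : R) : {nonneg R} := NngNum (nneg_part_subproof s).

Definition tadd (s t : {nonneg R}) : {nonneg R} := (s%:num + t%:num)%:nng.

Definition tshift {T : Type} (d : {nonneg R}) (w : {nonneg R} -> T) :
  {nonneg R} -> T := fun t => w (tadd t d).

Definition tconcat {T : Type} (d : {nonneg R}) (v w : {nonneg R} -> T) :
    {nonneg R} -> T :=
  fun t => if t%:num <= d%:num then v t else w (nneg_part (t%:num - d%:num)).

(* Constant extension of w to the left of 0: regularity of w at a point t of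
   R_+ is regularity of [extend w] at t, also for t = 0. *)
Definition extend {T : Type} (w : {nonneg R} -> T) : R -> T :=
  fun s => w (nneg_part s).

Definition sup_norm_on {W : normedModType R} (J : set {nonneg R})
  (w : {nonneg R} -> W) : R := sup [set `|w s| | s in J].

End time.

(** * Piecewise continuous bounded functions *)

Section piecewise_continuous.
Context {R : realType} (W : normedModType R).

(* One-sided limits exist everywhere, and there are finitely many points of
   discontinuity in every bounded interval. *)
Definition piecewise_continuous (w : {nonneg R} -> W) : Prop :=
  (forall t : R, cvg (extend w s @[s --> t^'-]) /\
                 cvg (extend w s @[s --> t^'+])) /\
  (forall T : R,
     finite_set [set t | t <= T /\ ~ {for t, continuous (extend w)}]).

Definition bounded_fun_on_time (w : {nonneg R} -> W) : Prop :=
  exists M : R, forall t, `|w t| <= M.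

Record PCb := MkPCb {
  PCb_fun :> {nonneg R} -> W;
  PCb_piecewise : piecewise_continuous PCb_fun;
  PCb_bounded : bounded_fun_on_time PCb_fun }.

Lemma PCb_eq (v w : PCb) : (forall t, v t = w t) -> v = w.
Proof.
case: v w => [v vc vb] [w wc wb] /= vw.
have {}vw : v = w by apply/funext.
by subst w; congr MkPCb; exact: Prop_irrelevance.
Qed.

HB.instance Definition _ := gen_eqMixin PCb.
HB.instance Definition _ := gen_choiceMixin PCb.

Lemma piecewise_continuous_cst (c : W) : piecewise_continuous (fun=> c).
Proof.
split=> [t|T]; first by split; exact: is_cvg_cst.
suff -> : [set t : R | t <= T /\ ~ {for t, continuous (extend (fun=> c))}] = set0.
  exact: finite_set0.
by apply/seteqP; split => t //= [_]; apply; exact: cvg_cst.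
Qed.

Lemma piecewise_continuousZ (a : R) w :
  piecewise_continuous w -> piecewise_continuous (fun t => a *: w t).
Proof.
case=> wl wd; split=> [t|T].
  by have [h1 h2] := wl t; split; apply: is_cvgZl_tmp.
apply: sub_finite_set (wd T) => t [tT /= h]; split => // h'; apply: h.
exact: cvgZl_tmp h'.
Qed.

Lemma piecewise_continuousD v w : piecewise_continuous v ->
  piecewise_continuous w -> piecewise_continuous (fun t => v t + w t).
Proof.
move=> [vl vd] [wl wd]; split=> [t|T].
  have [h1 h2] := vl t; have [h3 h4] := wl t.
  by split; apply: is_cvgD.
have : finite_set ([set t | t <= T /\ ~ {for t, continuous (extend v)}] `|`
  [set t | t <= T /\ ~ {for t, continuous (extend w)}]) by rewrite finite_setU.
apply: sub_finite_set => t [tT /= h].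
have [cv|cv] := pselect {for t, continuous (extend v)}; last by left.
right; split => // cw; apply: h; exact: cvgD cv cw.
Qed.

Lemma at_right_addr (d t : R) : s + d @[s --> t^'+] --> (t + d)^'+.
Proof.
move=> P [e /= e0 h]; exists e => //= s.
rewrite /ball_/= => st ts; apply: h => /=; last by rewrite ltrD2r.
by rewrite opprD addrACA subrr addr0.
Qed.

Lemma at_left_addr (d t : R) : s + d @[s --> t^'-] --> (t + d)^'-.
Proof.
move=> P [e /= e0 h]; exists e => //= s.
rewrite /ball_/= => st ts; apply: h => /=; last by rewrite ltrD2r.
by rewrite opprD addrACA subrr addr0.
Qed.

Lemma nbhs_addr (d t : R) : s + d @[s --> t] --> t + d.
Proof. by apply: cvgD; [exact: cvg_id|exact: cvg_cst]. Qed.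

Lemma cvg_near {F : set_system R} {FF : Filter F} (f g : R -> W) :
  (\forall s \near F, g s = f s) -> cvg (f s @[s --> F]) -> cvg (g s @[s --> F]).
Proof.
move=> gf /cvg_ex[l fl]; apply/cvg_ex; exists l; apply: cvg_trans fl.
by apply: near_eq_cvg; apply: filterS gf => s ->.
Qed.

Lemma continuous_near (f g : R -> W) (t : R) :
  (\forall s \near t, g s = f s) ->
  {for t, continuous f} -> {for t, continuous g}.
Proof.
move=> gf ft; have e : g t = f t by exact: nbhs_singleton gf.
rewrite /prop_for /continuous_at e; apply: cvg_trans ft.
by apply: near_eq_cvg; apply: filterS gf => s ->.
Qed.

Lemma is_cvg_right_addr (f : R -> W) (d t : R) :
  cvg (f s @[s --> (t + d)^'+]) -> cvg (f (s + d) @[s --> t^'+]).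
Proof.
move=> /cvg_ex[l fl]; apply/cvg_ex; exists l.
by have := cvg_comp (fun s => s + d) f (@at_right_addr d t) fl.
Qed.

Lemma is_cvg_left_addr (f : R -> W) (d t : R) :
  cvg (f s @[s --> (t + d)^'-]) -> cvg (f (s + d) @[s --> t^'-]).
Proof.
move=> /cvg_ex[l fl]; apply/cvg_ex; exists l.
by have := cvg_comp (fun s => s + d) f (@at_left_addr d t) fl.
Qed.

Lemma nneg_part_neg (s : R) : s <= 0 -> nneg_part s = 0%:nng.
Proof. by move=> s0; apply: val_inj => /=; rewrite max_r. Qed.

Lemma nneg_part_pos (s : R) : 0 <= s -> (nneg_part s)%:num = s.
Proof. by move=> s0 /=; rewrite max_l. Qed.

Lemma extend_tshift (w : {nonneg R} -> W) (d : {nonneg R}) (s : R) :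
  0 <= s -> extend (tshift d w) s = extend w (s + d%:num).
Proof.
move=> s0; rewrite /extend /tshift; congr w; apply: val_inj => /=.
by rewrite (max_l s0) max_l// addr_ge0.
Qed.

Lemma piecewise_continuous_tshift (d : {nonneg R}) w :
  piecewise_continuous w -> piecewise_continuous (tshift d w).
Proof.
move=> [wl wd].
have neg (t : R) : t <= 0 -> extend (tshift d w) t = tshift d w 0%:nng.
  by move=> t0; rewrite /extend nneg_part_neg.
split=> [t|T].
  have [t0|t0|t0] := ltgtP t 0; split.
  - apply: (@cvg_near _ _ (cst (tshift d w 0%:nng))); last exact: is_cvg_cst.
    by near=> s; apply: neg; apply: le_trans (ltW t0); near: s; apply: nbhs_left_le.
  - apply: (@cvg_near _ _ (cst (tshift d w 0%:nng))); last exact: is_cvg_cst.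
    by near=> s; apply: neg; near: s; apply: nbhs_right_le.
  - apply: (@cvg_near _ _ (fun s => extend w (s + d%:num))).
      by near=> s; apply: extend_tshift; near: s; apply: nbhs_left_ge.
    by apply: is_cvg_left_addr; case: (wl (t + d%:num)).
  - apply: (@cvg_near _ _ (fun s => extend w (s + d%:num))).
      near=> s; apply: extend_tshift; apply: ltW.
      by apply: lt_trans t0 _; near: s; apply: nbhs_right_gt.
    by apply: is_cvg_right_addr; case: (wl (t + d%:num)).
  - apply: (@cvg_near _ _ (cst (tshift d w 0%:nng))); last exact: is_cvg_cst.
    near=> s; apply: neg; rewrite -t0; apply: ltW.
    by near: s; apply: nbhs_left_lt.
  - apply: (@cvg_near _ _ (fun s => extend w (s + d%:num))).
      near=> s; apply: extend_tshift; rewrite -t0; apply: ltW.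
      by near: s; apply: nbhs_right_gt.
    by apply: is_cvg_right_addr; case: (wl (t + d%:num)).
have : finite_set ([set 0] `|` (fun s => s - d%:num) @`
  [set t | t <= T + d%:num /\ ~ {for t, continuous (extend w)}]).
  by rewrite finite_setU; split; [exact: finite_set1|exact: finite_image].
apply: sub_finite_set => t [tT /= h].
have [t0|t0|t0] := ltgtP t 0; last by left.
- exfalso; apply: h; apply: (@continuous_near (cst (tshift d w 0%:nng))).
    by near=> s; apply: neg; apply: ltW; near: s; apply: lt_nbhsl.
  exact: cvg_cst.
- right; exists (t + d%:num); last by rewrite addrK.
  split; first by rewrite lerD2r.
  move=> c; apply: h.
  apply: (@continuous_near (fun s => extend w (s + d%:num))).
    by near=> s; apply: extend_tshift; apply: ltW; near: s; apply: lt_nbhsr.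
  exact: cvg_comp (@nbhs_addr d%:num t) c.
Unshelve. all: by end_near. Qed.

Lemma extend_tconcat_le (d : {nonneg R}) (v w : {nonneg R} -> W) (s : R) :
  s <= d%:num -> extend (tconcat d v w) s = extend v s.
Proof. by move=> sd; rewrite /extend /tconcat /= ge_max sd ge0. Qed.

Lemma extend_tconcat_gt (d : {nonneg R}) (v w : {nonneg R} -> W) (s : R) :
  d%:num < s -> extend (tconcat d v w) s = extend w (s - d%:num).
Proof.
move=> ds; have s0 : 0 <= s by apply: ltW; apply: le_lt_trans ds.
by rewrite /extend /tconcat /= (max_l s0) leNgt ds.
Qed.

Lemma piecewise_continuous_tconcat (d : {nonneg R}) v w :
  piecewise_continuous v -> piecewise_continuous w ->
  piecewise_continuous (tconcat d v w).
Proof.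
move=> [vl vd] [wl wd]; split=> [t|T].
  have [td|dt] := ltP t d%:num; split.
  - apply: (@cvg_near _ _ (extend v)); last by case: (vl t).
    near=> s; apply: extend_tconcat_le; apply: ltW; apply: lt_trans td.
    by near: s; apply: nbhs_left_lt.
  - apply: (@cvg_near _ _ (extend v)); last by case: (vl t).
    by near=> s; apply: extend_tconcat_le; near: s; apply: nbhs_right_le.
  - move: dt; rewrite le_eqVlt => /predU1P[dt|dt].
      apply: (@cvg_near _ _ (extend v)); last by case: (vl t).
      near=> s; apply: extend_tconcat_le; rewrite dt; apply: ltW.
      by near: s; apply: nbhs_left_lt.
    apply: (@cvg_near _ _ (fun s => extend w (s - d%:num))).
      by near=> s; apply: extend_tconcat_gt; near: s; apply: nbhs_left_gt.
    by apply: is_cvg_left_addr; case: (wl (t - d%:num)).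
  - apply: (@cvg_near _ _ (fun s => extend w (s - d%:num))).
      near=> s; apply: extend_tconcat_gt; apply: le_lt_trans dt _.
      by near: s; apply: nbhs_right_gt.
    by apply: is_cvg_right_addr; case: (wl (t - d%:num)).
have : finite_set ([set d%:num] `|`
   ([set t | t <= T /\ ~ {for t, continuous (extend v)}] `|`
   (fun s => s + d%:num) @`
  [set t | t <= T - d%:num /\ ~ {for t, continuous (extend w)}])).
  rewrite !finite_setU; split; first exact: finite_set1.
  by split; [exact: vd|exact: finite_image].
apply: sub_finite_set => t [tT /= h].
have [td|td|td] := ltgtP t d%:num; last by left.
- right; left; split => // c; apply: h; apply: continuous_near c.
  by near=> s; apply: extend_tconcat_le; apply: ltW; near: s; apply: lt_nbhsl.
- right; right; exists (t - d%:num); last by rewrite subrK.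
  split; first by rewrite lerD2r.
  move=> c; apply: h.
  apply: (@continuous_near (fun s => extend w (s - d%:num))).
    by near=> s; apply: extend_tconcat_gt; near: s; apply: lt_nbhsr.
  exact: cvg_comp (@nbhs_addr (- d%:num) t) c.
Unshelve. all: by end_near. Qed.

Definition PCb_family (w : PCb) : linf_sum (fun _ : {nonneg R} => W) :=
  LinfSum (PCb_bounded w).

Definition PCb_zero : PCb :=
  MkPCb (piecewise_continuous_cst 0)
    (linf_bounded (0 : linf_sum (fun _ : {nonneg R} => W))).
Definition PCb_scale (a : R) (w : PCb) : PCb :=
  MkPCb (piecewise_continuousZ a (PCb_piecewise w))
    (linf_bounded (a *: PCb_family w)).
Definition PCb_add (v w : PCb) : PCb :=
  MkPCb (piecewise_continuousD (PCb_piecewise v) (PCb_piecewise w))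
    (linf_bounded (PCb_family v + PCb_family w)).
Definition PCb_opp (w : PCb) : PCb := PCb_scale (-1) w.

Fact PCb_addA : associative PCb_add.
Proof. by move=> x y z; apply: PCb_eq => i /=; rewrite addrA. Qed.
Fact PCb_addC : commutative PCb_add.
Proof. by move=> x y; apply: PCb_eq => i /=; rewrite addrC. Qed.
Fact PCb_add0 : left_id PCb_zero PCb_add.
Proof. by move=> x; apply: PCb_eq => i /=; rewrite add0r. Qed.
Fact PCb_addN : left_inverse PCb_zero PCb_opp PCb_add.
Proof. by move=> x; apply: PCb_eq => i /=; rewrite scaleN1r addNr. Qed.

HB.instance Definition _ :=
  GRing.isZmodule.Build PCb PCb_addA PCb_addC PCb_add0 PCb_addN.

Fact PCb_scaleA a b x : PCb_scale a (PCb_scale b x) = PCb_scale (a * b) x.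
Proof. by apply: PCb_eq => i /=; rewrite scalerA. Qed.
Fact PCb_scale1 : left_id 1 PCb_scale.
Proof. by move=> x; apply: PCb_eq => i /=; rewrite scale1r. Qed.
Fact PCb_scaleDr : right_distributive PCb_scale +%R.
Proof. by move=> a x y; apply: PCb_eq => i /=; rewrite scalerDr. Qed.
Fact PCb_scaleDl x : {morph PCb_scale^~ x : a b / a + b}.
Proof. by move=> a b; apply: PCb_eq => i /=; rewrite scalerDl. Qed.

HB.instance Definition _ := GRing.Zmodule_isLmodule.Build R PCb
  PCb_scaleA PCb_scale1 PCb_scaleDr PCb_scaleDl.

Definition PCb_norm (w : PCb) : R := sup_norm_on [set: {nonneg R}] w.

Lemma PCb_normE w : PCb_norm w = `|PCb_family w|.
Proof. by []. Qed.

Fact PCb_normD v w : PCb_norm (v + w) <= PCb_norm v + PCb_norm w.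
Proof. exact: (ler_normD (PCb_family v) (PCb_family w)). Qed.
Fact PCb_normZ (a : R) w : PCb_norm (a *: w) = `|a| * PCb_norm w.
Proof. exact: (normrZ a (PCb_family w)). Qed.
Fact PCb_norm0_eq0 w : PCb_norm w = 0 -> w = 0.
Proof.
move=> /(@normr0_eq0 _ _ (PCb_family w)) w0; apply: PCb_eq => t.
by rewrite -[LHS]/(PCb_family w t) w0.
Qed.

HB.instance Definition _ := Lmodule_isNormed.Build R PCb
  PCb_normD PCb_normZ PCb_norm0_eq0.

Fact PCb_shift_bounded (d : {nonneg R}) (w : PCb) :
  bounded_fun_on_time (tshift d w).
Proof. by have [M wM] := PCb_bounded w; exists M => t; exact: wM. Qed.

Definition PCb_shift (d : {nonneg R}) (w : PCb) : PCb :=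
  MkPCb (piecewise_continuous_tshift d (PCb_piecewise w)) (PCb_shift_bounded d w).

Lemma PCb_norm_shift d w : `|PCb_shift d w| <= `|w|.
Proof.
rewrite -[leLHS]/(linf_norm (PCb_family (PCb_shift d w))).
apply: linf_norm_le => [|t]; first exact: normr_ge0.
exact: (linf_norm_ub (PCb_family w)).
Qed.

Fact PCb_concat_bounded (d : {nonneg R}) (v w : PCb) :
  bounded_fun_on_time (tconcat d v w).
Proof.
have [M vM] := PCb_bounded v; have [N wN] := PCb_bounded w.
exists (Num.max M N) => t; rewrite /tconcat le_max.
by case: ifP => _; rewrite ?vM ?wN ?orbT.
Qed.

Definition PCb_concat (d : {nonneg R}) (v w : PCb) : PCb :=
  MkPCb (piecewise_continuous_tconcat d (PCb_piecewise v) (PCb_piecewise w))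
    (PCb_concat_bounded d v w).

End piecewise_continuous.

(** * Input spaces *)

(* A normed space realised, through the injective linear map [input_val], as a
   linear subspace of the space of all maps from R_+ to U. *)
Record input_space {R : realType} (U : lmodType R) := InputSpace {
  input_car :> normedModType R;
  input_val : input_car -> {nonneg R} -> U;
  input_linear : forall (a : R) (u v : input_car) t,
    input_val (a *: u + v) t = a *: input_val u t + input_val v t;
  input_inj : forall u v : input_car,
    (forall t, input_val u t = input_val v t) -> u = v;
  input_shift : {nonneg R} -> input_car -> input_car;
  input_shiftE : forall d u t,
    input_val (input_shift d u) t = tshift d (input_val u) t;
  input_norm_shift : forall d u, `|input_shift d u| <= `|u|;
  input_concat : forall (d : {nonneg R}) (u v : input_car), 0 < d%:num ->
    exists w : input_car,
      forall t, input_val w t = tconcat d (input_val u) (input_val v) t }.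

Section subsystem_inputs.
Context {R : realType} {U : lmodType R} (W : normedModType R)
  (V : input_space U).

Let val (p : PCb W * V) (t : {nonneg R}) : W * U := (p.1 t, input_val p.2 t).

Let shift (d : {nonneg R}) (p : PCb W * V) : PCb W * V :=
  (PCb_shift d p.1, input_shift d p.2).

Fact subsystem_input_linear (a : R) p q t :
  val (a *: p + q) t = a *: val p t + val q t.
Proof. by rewrite /val /= input_linear. Qed.

Fact subsystem_input_inj p q : (forall t, val p t = val q t) -> p = q.
Proof.
case: p q => [w u] [w' u'] h; congr pair.
  by apply: PCb_eq => t; have [] := h t.
by apply: input_inj => t; have [] := h t.
Qed.

Fact subsystem_input_shiftE d p t : val (shift d p) t = tshift d (val p) t.
Proof. by rewrite /val /= input_shiftE. Qed.

Fact subsystem_input_norm_shift d p : `|shift d p| <= `|p|.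
Proof.
rewrite !prod_normE /= ge_max !le_max PCb_norm_shift /=.
by rewrite input_norm_shift orbT.
Qed.

Fact subsystem_input_concat (d : {nonneg R}) p q : 0 < d%:num ->
  exists w, forall t, val w t = tconcat d (val p) (val q) t.
Proof.
move=> d0; have [w wE] := input_concat p.2 q.2 d0.
exists (PCb_concat d p.1 q.1, w) => t; rewrite /val /= wE /tconcat.
by case: ifP.
Qed.

(* PC_b(R_+, W) x V, as a space of maps from R_+ to W x U; the norm of the
   product normed module is the maximum of the two norms. *)
Definition subsystem_input : input_space (W * U)%type :=
  @InputSpace R (W * U)%type (PCb W * V)%type val
    subsystem_input_linear subsystem_input_inj shift subsystem_input_shiftE
    subsystem_input_norm_shift subsystem_input_concat.

End subsystem_inputs.

(** * Control systems *)

Section control_systems.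
Context {R : realType} {X : normedModType R} {U : lmodType R}
  {V : input_space U}.

(* A map D -> X with D included in R_+ x X x V; the values of [pval] outside
   the domain are irrelevant. *)
Record partial_flow := PartialFlow {
  pdom : {nonneg R} -> X -> V -> Prop;
  pval : {nonneg R} -> X -> V -> X }.

Definition pflow_extends (phi psi : partial_flow) : Prop :=
  forall t x u, pdom phi t x u ->
    pdom psi t x u /\ pval psi t x u = pval phi t x u.

Definition pflow_eq (phi psi : partial_flow) : Prop :=
  pflow_extends phi psi /\ pflow_extends psi phi.

Definition escape_time (phi : partial_flow) (x : X) (u : V) (tm : \bar R) :=
  (0 < tm)%E /\ forall t : {nonneg R}, pdom phi t x u <-> (t%:num%:E < tm)%E.

Definition is_control_system (phi : partial_flow) : Prop :=
  [/\ (forall x u, exists tm, escape_time phi x u tm),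
      (forall x u, pval phi 0%:nng x u = x),
      (forall (t : {nonneg R}) x (u v : V), pdom phi t x u ->
         (forall s : {nonneg R}, s%:num <= t%:num ->
            input_val v s = input_val u s) ->
         (forall s : {nonneg R}, s%:num <= t%:num -> pdom phi s x v) /\
         pval phi t x u = pval phi t x v),
      (forall t x u, pdom phi t x u ->
         {for t%:num, continuous (extend (fun s => pval phi s x u))}) &
      (forall (t h : {nonneg R}) x u,
         (forall s : {nonneg R}, s%:num <= t%:num + h%:num -> pdom phi s x u) ->
         pdom phi h (pval phi t x u) (input_shift t u) /\
         pval phi h (pval phi t x u) (input_shift t u) =
         pval phi (tadd t h) x u)].

End control_systems.
Arguments partial_flow {R} X {U} V.

Record control_system {R : realType} (X : normedModType R) {U : lmodType R}
    (V : input_space U) := ControlSystem {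
  flow :> partial_flow X V;
  flow_axioms : is_control_system flow }.

Section properties.
Context {R : realType} {X : normedModType R} {U : lmodType R}
  {V : input_space U}.

Definition forward_complete (S : control_system X V) : Prop :=
  forall t x u, pdom S t x u.

Definition has_BIC (S : control_system X V) : Prop :=
  forall x u tm, escape_time S x u tm -> (tm < +oo)%E ->
  forall M : R, 0 < M ->
  exists t : {nonneg R}, (t%:num%:E < tm)%E /\ M < `|pval S t x u|.

Definition ISS (S : control_system X V) : Prop :=
  exists beta gamma, [/\ class_KL beta, class_K0 gamma &
    forall t x u, pdom S t x u ->
      `|pval S t x u| <= beta `|x| t%:num + gamma `|u|].

End properties.

(** * Interconnections *)

Section interconnection.
Context {R : realType} {I : Type} (X : I -> normedModType R) {U : lmodType R}
  (V : input_space U).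

Definition subsystem (i : I) : Type :=
  control_system (X i) (subsystem_input (linf_except X i) V).

Context (S : forall i, subsystem i).

(* [w] is a globally bounded piecewise continuous function that agrees on
   [0, t] with the trajectory of the other subsystems; by causality the value
   of the i-th flow at time t does not depend on its choice. *)
Definition interconnection_flow (phi : partial_flow (linf_sum X) V) : Prop :=
  (forall x u, exists e : R, 0 < e /\
     forall t : {nonneg R}, t%:num <= e -> pdom phi t x u) /\
  (forall t x u, pdom phi t x u -> forall i,
     exists w : PCb (linf_except X i),
       [/\ (forall s : {nonneg R}, s%:num <= t%:num ->
              pdom phi s x u /\ w s = linf_restrict i (pval phi s x u)),
           pdom (S i) t (x i) (w, u) &
           pval phi t x u i = pval (S i) t (x i) (w, u)]).

Definition maximal_interconnection_flow (phi : partial_flow (linf_sum X) V) :=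
  interconnection_flow phi /\
  forall psi, interconnection_flow psi -> pflow_extends phi psi ->
    pflow_eq phi psi.

Definition is_interconnection (Sigma : control_system (linf_sum X) V) : Prop :=
  [/\ maximal_interconnection_flow Sigma,
      (forall psi, maximal_interconnection_flow psi -> pflow_eq Sigma psi) &
      has_BIC Sigma].

End interconnection.

Section semi_maximum.
Context {R : realType} {I : Type} {X : I -> normedModType R} {U : lmodType R}
  {V : input_space U}.

(* The term j = i of the supremum is 0. *)
Definition ISS_semimax (i : I) (S : subsystem X V i) (beta : R -> R -> R)
    (gam : I -> R -> R) (gamu : R -> R) : Prop :=
  [/\ forward_complete S,
      class_KL beta /\ class_K0 gamu,
      (forall j, class_K0 (gam j)) /\ (forall r, 0 <= r -> gam i r = 0),
      (forall r, 0 <= r -> has_ubound [set gam j r | j in [set: I]]) &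
      forall (x : X i) (w : PCb (linf_except X i)) (u : V) (t : {nonneg R}),
        `|pval S t x (w, u)| <= beta `|x| t%:num
          + sup ([set 0] `|`
              [set gam (sval j)
                     (sup_norm_on [set s | s%:num <= t%:num] (fun s => w s j))
              | j in [set: {j : I | j <> i}]])
          + gamu `|u|].

End semi_maximum.

(** * The linear gain operator *)

Section gain_operator.
Context {R : realType} {I : Type}.

(* The cone of nonnegative elements of l_infty(I). *)
Definition linf_cone : set (I -> R) :=
  [set s | (forall i, 0 <= s i) /\ exists M, forall i, s i <= M].

Definition Gamma_max (g : I -> I -> R) (s : I -> R) : I -> R :=
  fun i => sup [set g i j * s j | j in [set: I]].

(* The suprema are finite, and the operator maps the cone to itself. *)
Definition Gamma_max_well_defined (g : I -> I -> R) : Prop :=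
  forall s, linf_cone s ->
    (forall i, has_ubound [set g i j * s j | j in [set: I]]) /\
    linf_cone (Gamma_max g s).

(* Supremum of the products of gains along the paths of length n. *)
Definition sup_path_gain (g : I -> I -> R) (n : nat) : R :=
  sup [set \prod_(k < n) g (j k) (j k.+1) | j in [set: nat -> I]].

Definition path_gain_root (g : I -> I -> R) (n : nat) : R :=
  sup_path_gain g n `^ n%:R^-1.

End gain_operator.

(* Main.v *)
(** Discounting every step of a path by a factor q < 1 larger than the limit of
    the path-gain roots, the supremum om_i of the discounted gains of the paths
    issued from i lies in [1, C] and satisfies g_ij om_j <= q om_i.  In the norms
    |x_i| / om_i all gains are thus at most q, and a trajectory with weighted norm
    v satisfies v(t) <= beta_max(|x|, t) + q sup_[0,t] v + gamma_max(|u|).  This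
    bounds v by (beta_max(|x|, 0) + gamma_max(|u|)) / (1 - q).  Restarting at t / 2
    and iterating, a trajectory bounded by B satisfies
      v(t) <= sum_k q^k beta_max(B, t / 2^(k+1)) + gamma_max(|u|) / (1 - q),
    whose sum is a KL function of (B, t).  If gamma_max(|u|) <= beta_max(|x|, 0),
    B can be chosen as a K function of |x|; otherwise the uniform bound is already
    at most 2 gamma_max(|u|) / (1 - q). *)

Require Import Defs.
From HB Require Import structures.
From mathcomp Require Import all_boot all_order all_algebra.
From mathcomp Require Import all_classical all_reals all_analysis.
From mathcomp Require Import ring lra.

Set Implicit Arguments.
Unset Strict Implicit.
Unset Printing Implicit Defensive.

Import Order.TTheory GRing.Theory Num.Theory.
Import numFieldNormedType.Exports.

Local Open Scope classical_set_scope.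
Local Open Scope ring_scope.

(** * Monotonicity, construction and closure properties of comparison functions *)

Section comparison_function_theory.
Context {R : realType}.
Implicit Types (g : R -> R) (b : R -> R -> R).

Lemma within_continuous_comp_into (T W : topologicalType) (A : set T)
    (h : T -> T) (f : T -> W) :
  {within A, continuous f} -> continuous h -> (forall x, A (h x)) ->
  continuous (f \o h).
Proof.
move=> /subspace_continuousP cf ch hA x; apply: cvg_comp (cf _ (hA x)).
move=> B /= wB; apply: (@filterS _ (nbhs x) _ _ _ _ (ch x _ wB)) => y /=; apply; exact: hA.
Qed.

Lemma continuous_compT (T W W' : topologicalType) (f : T -> W) (h : W -> W') :
  continuous f -> continuous h -> continuous (fun x => h (f x)).
Proof. by move=> cf ch x; exact: continuous_comp (cf x) (ch (f x)). Qed.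

Lemma continuous_fst (T W : topologicalType) : continuous (@fst T W).
Proof. by move=> x; exact: cvg_fst. Qed.

Lemma continuous_snd (T W : topologicalType) : continuous (@snd T W).
Proof. by move=> x; exact: cvg_snd. Qed.

Lemma continuous_pair (T W W' : topologicalType) (f : T -> W) (h : T -> W') :
  continuous f -> continuous h -> continuous (fun y => (f y, h y)).
Proof.
move=> cf ch x; exact: (@cvg_pair _ _ _ (nbhs x) (nbhs (f x)) (nbhs (h x)) _ _ _ _ _ (cf x) (ch x)).
Qed.

Lemma continuous_max0 : continuous (fun s : R => Num.max s 0).
Proof.
by move=> x; apply: (@continuous_max R R id (cst 0)); [exact: cvg_id|exact: cvg_cst].
Qed.

Lemma max0_ge0 (s : R) : 0 <= Num.max s 0.
Proof. by rewrite le_max lexx orbT. Qed.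

(** Clamping the argument with [Num.max s 0] trades continuity within the half-line for continuity
    on all of R, so that sums, products and compositions need no subspace topology. *)
Lemma class_K_continuous g :
  class_K g -> continuous (fun s : R => g (Num.max s 0)).
Proof.
move=> [cg _ _].
have := @within_continuous_comp_into R R `[0, +oo[ _ g cg continuous_max0.
by apply=> x; rewrite /= in_itv /= max0_ge0.
Qed.

Lemma class_KL_continuous b : class_KL b ->
  continuous (fun p : R * R => b (Num.max p.1 0) (Num.max p.2 0)).
Proof.
move=> [cb _ _].
have ch : continuous (fun p : R * R => (Num.max p.1 0, Num.max p.2 0)).
  exact: (continuous_pair (continuous_compT (@continuous_fst R R) continuous_max0)
    (continuous_compT (@continuous_snd R R) continuous_max0)).
apply: (within_continuous_comp_into cb ch) => p.
by rewrite /= !in_itv /= !max0_ge0.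
Qed.

Lemma class_KI g :
  continuous (fun s : R => g (Num.max s 0)) ->
  (forall r s, 0 <= r -> r < s -> g r < g s) -> g 0 = 0 -> class_K g.
Proof.
move=> cg gi g0; split => //.
apply: subspace_eq_continuous (continuous_subspaceT cg) => x.
by rewrite inE /= in_itv /= andbT => x0; rewrite /from_subspace max_l.
Qed.

Lemma class_LI g :
  continuous (fun s : R => g (Num.max s 0)) ->
  (forall t, 0 <= t -> 0 <= g t) ->
  (forall s t, 0 <= s -> s < t -> g t < g s) ->
  g t @[t --> +oo] --> (0 : R) -> class_L g.
Proof.
move=> cg *; split => //.
apply: subspace_eq_continuous (continuous_subspaceT cg) => x.
by rewrite inE /= in_itv /= andbT => x0; rewrite /from_subspace max_l.
Qed.

Lemma class_K_le g r s : class_K g -> 0 <= r -> r <= s -> g r <= g s.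
Proof.
move=> [_ gi _] r0; rewrite le_eqVlt => /predU1P[->//|rs].
exact/ltW/gi.
Qed.

Lemma class_K_ge0 g r : class_K g -> 0 <= r -> 0 <= g r.
Proof. by move=> gK r0; have [_ _ <-] := gK; exact: class_K_le. Qed.

Lemma class_KL_ge0 b r t : class_KL b -> 0 <= r -> 0 <= t -> 0 <= b r t.
Proof. by move=> [_ bK _] r0 t0; exact: (class_K_ge0 (bK t t0)). Qed.

Lemma class_KL_le b r s t : class_KL b ->
  0 <= r -> r <= s -> 0 <= t -> b r t <= b s t.
Proof. by move=> [_ bK _] r0 rs t0; exact: (class_K_le (bK t t0)). Qed.

Lemma class_KL_le_time b r s t : class_KL b ->
  0 <= r -> 0 <= s -> s <= t -> b r t <= b r s.
Proof.
move=> [_ bK bL] r0 s0 st; have t0 := le_trans s0 st.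
(* The class L property is available only for positive [r]; at [r = 0] both sides vanish. *)
move: r0; rewrite le_eqVlt => /predU1P[<-|r0].
  by have [_ _ ->] := bK t t0; have [_ _ ->] := bK s s0.
move: st; rewrite le_eqVlt => /predU1P[->//|st].
by have [_ _ bi _] := bL r r0; exact/ltW/bi.
Qed.

Lemma class_KLI b :
  continuous (fun p : R * R => b (Num.max p.1 0) (Num.max p.2 0)) ->
  (forall t, 0 <= t -> b 0 t = 0) ->
  (forall r s t, 0 <= r -> r < s -> 0 <= t -> b r t < b s t) ->
  (forall r s t, 0 < r -> 0 <= s -> s < t -> b r t < b r s) ->
  (forall r, 0 < r -> b r t @[t --> +oo] --> (0 : R)) ->
  class_KL b.
Proof.
move=> cb b0 br bt blim.
(* Nonnegativity comes from the value 0 at [r = 0] and strict growth in the first argument. *)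
have bge0 r t : 0 <= r -> 0 <= t -> 0 <= b r t.
  rewrite le_eqVlt => /predU1P[<- t0|r0 t0]; first by rewrite b0.
  by rewrite -(b0 t t0); apply/ltW/br.
split.
- apply: subspace_eq_continuous (continuous_subspaceT cb) => -[x y].
  by rewrite inE /= !in_itv /= !andbT => -[x0 y0]; rewrite /from_subspace /= !max_l.
- move=> t t0; apply: class_KI => [x|r s r0 rs|]; [|exact: br|exact: b0].
  have ch : continuous (fun s : R => (s, t)).
    by apply: continuous_pair => z; [exact: cvg_id|exact: cvg_cst].
  by have := @continuous_compT _ _ _ _ _ ch cb x; rewrite /continuous_at /= (max_l t0).
- move=> r r0; apply: class_LI => [x|t t0|s t s0 st|].
  + have ch : continuous (fun s : R => (r, s)).
      by apply: continuous_pair => z; [exact: cvg_cst|exact: cvg_id].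
    by have := @continuous_compT _ _ _ _ _ ch cb x; rewrite /continuous_at /= (max_l (ltW r0)).
  + exact: bge0 (ltW r0) t0.
  + exact: bt.
  + exact: blim.
Qed.

Lemma class_K_scale (c : R) g : 0 < c -> class_K g -> class_K (fun s => c * g s).
Proof.
move=> c0 gK; have [_ gi g0] := gK; apply: class_KI => [|r s r0 rs|].
- by move=> x; apply: cvgMl_tmp; exact: class_K_continuous.
- by rewrite ltr_pM2l// gi.
- by rewrite g0 mulr0.
Qed.

Lemma class_KL_scale (c : R) b :
  0 < c -> class_KL b -> class_KL (fun s t => c * b s t).
Proof.
move=> c0 bKL; have [_ bK bL] := bKL.
apply: class_KLI => [x|t t0|r s t r0 rs t0|r s t r0 s0 st|r r0].
- by apply: cvgMl_tmp; exact: class_KL_continuous.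
- by have [_ _ ->] := bK t t0; rewrite mulr0.
- by have [_ bi _] := bK t t0; rewrite ltr_pM2l// bi.
- by have [_ _ bi _] := bL r r0; rewrite ltr_pM2l// bi.
- by have [_ _ _ bl] := bL r r0; rewrite -[X in _ --> X](mulr0 c); exact: cvgMl_tmp.
Qed.

Lemma class_KL_comp g b :
  class_K g -> class_KL b -> class_KL (fun s t => b (g s) t).
Proof.
move=> gK bKL; have [_ bK bL] := bKL; have [_ gi g0] := gK.
have gge0 s : 0 <= s -> 0 <= g s by exact: class_K_ge0.
have ggt0 s : 0 < s -> 0 < g s by rewrite -{2}g0; exact: gi.
apply: class_KLI => [x|t t0|r s t r0 rs t0|r s t r0 s0 st|r r0].
- have ch : continuous (fun p : R * R => (g (Num.max p.1 0), p.2)).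
    exact: (continuous_pair (continuous_compT (@continuous_fst R R)
    (class_K_continuous gK)) (@continuous_snd R R)).
  have := @continuous_compT _ _ _ _ _ ch (class_KL_continuous bKL) x.
  (* The outer clamp acts trivially, since [g] is nonnegative on the half-line. *)
  rewrite /continuous_at /= max_l ?gge0 ?max0_ge0//; apply: cvg_trans.
  apply: near_eq_cvg; apply: nearW => y /=.
  by rewrite max_l ?gge0 ?max0_ge0.
- by rewrite g0; have [_ _ ->] := bK t t0.
- by have [_ bi _] := bK t t0; rewrite bi ?gge0 ?gi.
- by have [_ _ bi _] := bL _ (ggt0 r r0); rewrite bi.
- by have [_ _ _ bl] := bL _ (ggt0 r r0).
Qed.

Lemma class_KL_add b b' :
  class_KL b -> class_KL b' -> class_KL (fun s t => b s t + b' s t).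
Proof.
move=> bKL bKL'; have [_ bK bL] := bKL; have [_ bK' bL'] := bKL'.
apply: class_KLI => [x|t t0|r s t r0 rs t0|r s t r0 s0 st|r r0].
- by apply: cvgD; exact: class_KL_continuous.
- by have [_ _ ->] := bK t t0; have [_ _ ->] := bK' t t0; rewrite addr0.
- have [_ bi _] := bK t t0; have [_ bi' _] := bK' t t0.
  by rewrite ltrD// (bi, bi').
- have [_ _ bi _] := bL r r0; have [_ _ bi' _] := bL' r r0.
  by rewrite ltrD// (bi, bi').
- have [_ _ _ bl] := bL r r0; have [_ _ _ bl'] := bL' r r0.
  by rewrite -[X in _ --> X](addr0 0); exact: cvgD.
Qed.

Lemma class_KL_time_scale (c : R) b :
  0 < c -> class_KL b -> class_KL (fun s t => b s (t * c)).
Proof.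
move=> c0 bKL; have [_ bK bL] := bKL.
have tc0 t : 0 <= t -> 0 <= t * c by move=> t0; rewrite mulr_ge0// ltW.
apply: class_KLI => [x|t t0|r s t r0 rs t0|r s t r0 s0 st|r r0].
- have ct : continuous (fun t : R => Num.max t 0 * c).
    by move=> t; apply: cvgMr_tmp; exact: continuous_max0.
  have ch := continuous_pair (@continuous_fst R R)
    (continuous_compT (@continuous_snd R R) ct).
  have := @continuous_compT _ _ _ _ _ ch (class_KL_continuous bKL) x.
  rewrite /continuous_at /= (max_l (tc0 _ (max0_ge0 x.2))).
  apply: cvg_trans; apply: near_eq_cvg; apply: nearW => y /=.
  by rewrite (max_l (tc0 _ (max0_ge0 _))).
- by have [_ _ ->] := bK _ (tc0 t t0).
- by have [_ bi _] := bK _ (tc0 t t0); exact: bi.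
- by have [_ _ bi _] := bL r r0; rewrite bi ?tc0// ltr_pM2r.
- have [_ _ _ bl] := bL r r0.
  have ct : t * c @[t --> +oo] --> (+oo : set_system R).
    by apply: gt0_cvgMly c0 _; exact: cvg_id.
  exact: cvg_comp ct bl.
Qed.

End comparison_function_theory.

(** * The discounted series of a KL function at halved times *)

Section halving_sum.
Context {R : realType} (q : R) (b : R -> R -> R).
Hypotheses (q_gt0 : 0 < q) (q_lt1 : q < 1) (b_KL : class_KL b).

(** The term of index [k] stems from [k + 1] halvings of the time but only [k] applications of the
    gain, hence the two different exponents. *)
Definition halving_term (s t : R) (k : nat) : R := q ^+ k * b s (t / 2 ^+ k.+1).

Definition halving_sum (s t : R) : R := limn (series (halving_term s t)).

Let q_ge0 : 0 <= q := ltW q_gt0.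
Let q1_gt0 : 0 < 1 - q. Proof. by rewrite subr_gt0. Qed.

Lemma halving_term_KL k : class_KL (fun s t => halving_term s t k).
Proof.
apply: class_KL_scale; first exact: exprn_gt0.
by apply: class_KL_time_scale => //; rewrite invr_gt0 exprn_gt0.
Qed.

Lemma halving_term_ge0 s t k : 0 <= s -> 0 <= t -> 0 <= halving_term s t k.
Proof. exact: (class_KL_ge0 (halving_term_KL k)). Qed.

(** The index is a successor because the empty sum is the zero function, which is not strictly
    monotone. *)
Lemma halving_partial_KL n :
  class_KL (fun s t => series (halving_term s t) n.+1).
Proof.
elim: n => [|n IHn].
  rewrite (_ : (fun _ _ => _) = (fun s t => halving_term s t 0)).
    exact: halving_term_KL.
  by apply/funext => s; apply/funext => t; rewrite /series /= big_nat1.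
rewrite (_ : (fun _ _ => _) =
    (fun s t => series (halving_term s t) n.+1 + halving_term s t n.+1)).
  by apply: class_KL_add; [exact: IHn|exact: halving_term_KL].
by apply/funext => s; apply/funext => t; rewrite /series /= big_nat_recr.
Qed.

(** Since [b] decreases in time, the term of index [k] is at most [q ^+ k * b s 0]; the rest is a
    finite geometric sum in closed form. *)
Lemma halving_partial_tail s t n m : 0 <= s -> 0 <= t -> (n <= m)%N ->
  series (halving_term s t) m <=
    series (halving_term s t) n + (q ^+ n - q ^+ m) * (b s 0 / (1 - q)).
Proof.
move=> s0 t0; elim: m => [|m IHm].
  by rewrite leqn0 => /eqP ->; rewrite subrr mul0r addr0.
rewrite leq_eqVlt => /predU1P[->|]; first by rewrite subrr mul0r addr0.
rewrite ltnS => nm; rewrite {1}/series /= big_nat_recr//=.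
rewrite (le_trans (lerD (IHm nm) (lexx _)))// -addrA lerD2l.
have -> : (q ^+ n - q ^+ m.+1) * (b s 0 / (1 - q)) =
    (q ^+ n - q ^+ m) * (b s 0 / (1 - q)) + q ^+ m * b s 0.
  by rewrite exprS; field; rewrite gt_eqF.
rewrite lerD2l ler_wpM2l ?exprn_ge0//.
by apply: class_KL_le_time => //; rewrite divr_ge0// exprn_ge0.
Qed.

Lemma halving_partial_nondecreasing s t : 0 <= s -> 0 <= t ->
  {homo series (halving_term s t) : n m / (n <= m)%N >-> n <= m}.
Proof.
move=> s0 t0 n m nm; rewrite /series /= (big_cat_nat _ nm)//= lerDl.
by rewrite sumr_ge0// => k _; exact: halving_term_ge0.
Qed.

Lemma halving_cvg s t : 0 <= s -> 0 <= t -> cvgn (series (halving_term s t)).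
Proof.
move=> s0 t0; apply: nondecreasing_is_cvgn.
  exact: halving_partial_nondecreasing.
exists (b s 0 / (1 - q)) => _ [m _ <-].
rewrite (le_trans (halving_partial_tail s0 t0 (leq0n m)))//.
rewrite /series /= big_geq// add0r expr0 ler_piMl ?gerBl ?exprn_ge0//.
by rewrite divr_ge0 ?(ltW q1_gt0)// (class_KL_ge0 b_KL).
Qed.

Lemma halving_partial_le s t n : 0 <= s -> 0 <= t ->
  series (halving_term s t) n <= halving_sum s t.
Proof.
move=> s0 t0; apply: nondecreasing_cvgn_le; last exact: halving_cvg.
exact: halving_partial_nondecreasing.
Qed.

(** This remainder is independent of [t] and controlled locally uniformly in [s], so continuity and
    decay pass from the partial sums to the limit. *)
Lemma halving_sum_tail s t n : 0 <= s -> 0 <= t ->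
  halving_sum s t <=
    series (halving_term s t) n + q ^+ n * (b s 0 / (1 - q)).
Proof.
move=> s0 t0; apply: limr_le; first exact: halving_cvg.
exists n => //= m /= nm.
rewrite (le_trans (halving_partial_tail s0 t0 nm))// lerD2l ler_wpM2r//.
  by rewrite divr_ge0 ?(ltW q1_gt0)// (class_KL_ge0 b_KL).
by rewrite gerBl exprn_ge0.
Qed.

(** A limit only preserves weak inequalities; the gap between the terms of index 0 is kept as a
    fixed margin through all nonempty partial sums. *)
Lemma halving_sum_lt s t s' t' :
  0 <= s -> 0 <= t -> 0 <= s' -> 0 <= t' ->
  (forall k, halving_term s t k <= halving_term s' t' k) ->
  halving_term s t 0 < halving_term s' t' 0 ->
  halving_sum s t < halving_sum s' t'.
Proof.
move=> s0 t0 s0' t0' le_term lt_term.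
rewrite -subr_gt0; apply: lt_le_trans (_ : 0 < _ - halving_term s t 0) _.
  by rewrite subr_gt0; exact: lt_term.
rewrite lerBrDl -lerBrDr; apply: limr_le; first exact: halving_cvg.
exists 1%N => //= -[//|n] _; rewrite lerBrDr.
apply: le_trans (halving_partial_le n.+1 s0' t0').
rewrite /series /= !(@big_ltn _ _ _ 0)//= addrAC [X in X + _]addrC subrK lerD2l.
exact: ler_sum_nat.
Qed.

(** The exponent is a successor so that [halving_partial_KL] applies to the matching partial sum. *)
Lemma halving_tail_small (M e : R) : 0 < e ->
  exists n, q ^+ n.+1 * (M / (1 - q)) <= e.
Proof.
move=> e0.
have : q ^+ n * (M / (1 - q)) @[n --> \oo] --> 0.
  rewrite -(mul0r (M / (1 - q))); apply: cvgMr_tmp.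
  by apply: cvg_expr; rewrite ger0_norm.
move=> /cvgrPdist_le /(_ e e0) [n _ /(_ n.+1 (leqnSn n))].
by rewrite sub0r normrN => h; exists n; apply: le_trans h; exact: ler_norm.
Qed.

Lemma halving_sum_continuous :
  continuous (fun p : R * R => halving_sum (Num.max p.1 0) (Num.max p.2 0)).
Proof.
move=> y; apply/cvgrPdist_le => e e0.
have e3 : 0 < e / 3 by rewrite divr_gt0.
pose B (p : R * R) := b (Num.max p.1 0) 0.
have cB : {for y, continuous B}.
  have ch : continuous (fun p : R * R => (p.1, 0 : R)).
    by apply: continuous_pair; [exact: continuous_fst|move=> ?; exact: cvg_cst].
  have := @continuous_compT _ _ _ _ _ ch (class_KL_continuous b_KL) y.
  by rewrite /continuous_at /= maxxx.
(* Near [y] the remainder constant [B] stays below [B y + 1], so one [n] serves a whole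
   neighbourhood. *)
have [n hn] := halving_tail_small (B y + 1) e3.
have /cvgrPdist_le /(_ _ e3) nF := @class_KL_continuous _ _ (halving_partial_KL n) y.
have nB : \forall p \near y, B p <= B y + 1.
  by apply: (cvgr_le _ cB); rewrite ltrDl.
pose F (p : R * R) := series (halving_term (Num.max p.1 0) (Num.max p.2 0)) n.+1.
have lo p : F p <= halving_sum (Num.max p.1 0) (Num.max p.2 0).
  exact: halving_partial_le (max0_ge0 _) (max0_ge0 _).
have hi p : B p <= B y + 1 ->
    halving_sum (Num.max p.1 0) (Num.max p.2 0) <= F p + e / 3.
  move=> Bp; apply: le_trans (halving_sum_tail n.+1 (max0_ge0 _) (max0_ge0 _)) _.
  rewrite lerD2l; apply: le_trans hn.
  by rewrite ler_wpM2l ?exprn_ge0// ler_wpM2r// invr_ge0 ltW.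
near=> p.
have Fyp : `|F y - F p| <= e / 3 by near: p; exact: nF.
have Bp : B p <= B y + 1 by near: p; exact: nB.
have hy : B y <= B y + 1 by rewrite lerDl.
move: Fyp (lo y) (lo p) (hi y hy) (hi p Bp); rewrite !ler_norml => /andP[].
by move: (F y) (F p) (halving_sum _ _) (halving_sum _ _) => *; apply/andP; split; lra.
Unshelve. all: by end_near. Qed.

Lemma halving_sum_KL : class_KL halving_sum.
Proof.
have hK k := halving_term_KL k.
apply: class_KLI => [||r s t r0 rs t0|r s t r0 s0 st|r r0].
- exact: halving_sum_continuous.
- move=> t t0; rewrite /halving_sum; apply/cvg_lim => //.
  rewrite (_ : series _ = cst 0); first exact: cvg_cst.
  apply/funext => n; rewrite /series /= big1// => k _.
  by have [_ bK _] := hK k; have [_ _ ->] := bK t t0.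
- have s0 := ltW (le_lt_trans r0 rs).
  apply: halving_sum_lt => // [k|]; first exact: (class_KL_le (hK k)) (ltW rs) t0.
  by have [_ bK _] := hK 0%N; have [_ bi _] := bK t t0; exact: bi.
- have t0 := ltW (le_lt_trans s0 st); have r0' := ltW r0.
  apply: halving_sum_lt => // [k|]; first exact: (class_KL_le_time (hK k)) (ltW st).
  by have [_ _ bL] := hK 0%N; have [_ _ bi _] := bL r r0; exact: bi.
(* Half of [e] pays for the remainder, uniformly in [t]; the other half pays for a fixed partial
   sum, which tends to 0. *)
- apply/cvgrPdist_le => e e0; have e2 : 0 < e / 2 by rewrite divr_gt0.
  have [n hn] := halving_tail_small (b r 0) e2.
  have [_ _ bL] := halving_partial_KL n; have [_ _ _ lim0] := bL r r0.
  move/cvgrPdist_le : lim0 => /(_ _ e2) nF.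
  near=> t.
  have t0 : 0 <= t by near: t; exact: nbhs_pinfty_ge.
  have := halving_sum_tail n.+1 (ltW r0) t0.
  have : 0 <= halving_sum r t.
    apply: le_trans (halving_partial_le 0 (ltW r0) t0).
    by rewrite /series /= big_geq.
  have : `|0 - series (halving_term r t) n.+1| <= e / 2 by near: t; exact: nF.
  rewrite !sub0r !normrN ler_norml => /andP[_ hF] F0 hF'.
  by rewrite ger0_norm//; lra.
Unshelve. all: by end_near. Qed.

End halving_sum.

(** * Geometric decay of path gains and the weights derived from it *)

Section gain_weight.
Context {R : realType} {I : Type} (g : I -> I -> R).
Hypothesis g_ge0 : forall i j, 0 <= g i j.

Definition path_gain (j : nat -> I) (n : nat) : R :=
  \prod_(k < n) g (j k) (j k.+1).

Lemma path_gain_ge0 j n : 0 <= path_gain j n.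
Proof. by apply: prodr_ge0 => k _; exact: g_ge0. Qed.

(** Applying the operator to the constant family 1 bounds all gains at once. *)
Lemma Gamma_max_gains_bounded :
  Gamma_max_well_defined g -> exists2 G, 0 <= G & forall i j, g i j <= G.
Proof.
move=> /(_ (fun=> 1)) []; first by split=> //; exists 1.
move=> gub [_ [M gM]]; exists (Num.max M 0); first by rewrite le_max lexx orbT.
move=> i j; rewrite le_max; apply/orP; left; apply: le_trans (gM i).
by apply: ub_le_sup; [exact: gub|exists j => //; rewrite mulr1].
Qed.

Lemma path_gain_le_exp G j n :
  (forall i j, g i j <= G) -> path_gain j n <= G ^+ n.
Proof.
move=> gG; have := @ler_prod _ _ (index_enum 'I_n) xpredT
  (fun k : 'I_n => g (j k) (j k.+1)) (fun=> G).
rewrite prodr_const card_ord; apply => k _.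
by rewrite g_ge0 gG.
Qed.

(** The root condition controls only long paths; the finitely many shorter lengths are absorbed into
    [C] by means of the uniform bound [G]. *)
Lemma path_gain_geometric : Gamma_max_well_defined g ->
  cvgn (path_gain_root g) -> limn (path_gain_root g) < 1 ->
  exists q C, [/\ 0 < q, q < 1, 0 <= C &
    forall j n, path_gain j n <= C * q ^+ n].
Proof.
move=> /Gamma_max_gains_bounded [G G0 gG] root_cvg root_lt1.
(* Truncating the limit at 0 makes the midpoint [q] of [l] and 1 positive. *)
pose l := Num.max (limn (path_gain_root g)) 0.
have l0 : 0 <= l by rewrite le_max lexx orbT.
have l1 : l < 1 by rewrite gt_max root_lt1 ltr01.
have ll : limn (path_gain_root g) <= l by rewrite le_max lexx.
pose q := (l + 1) / 2.
have q0 : 0 < q by rewrite divr_gt0// ltr_pwDr.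
have lq : limn (path_gain_root g) < q.
  by apply: le_lt_trans ll _; rewrite /q; lra.
have [N _ rootN] := cvgr_le _ root_cvg _ lq.
(* For [n < N] one has [G ^+ n = (G / q) ^+ n * q ^+ n], whose first factor is a summand of [C]; the
   summand 1 serves the other lengths. *)
pose C := 1 + \sum_(k < N) (G / q) ^+ k.
have Gq0 k : 0 <= (G / q) ^+ k by rewrite exprn_ge0// divr_ge0// ltW.
exists q, C; split => //; first by rewrite /q; lra.
  by rewrite addr_ge0// sumr_ge0.
move=> j n; have [nN|Nn] := ltnP n N.
  apply: le_trans (path_gain_le_exp j n gG) _.
  rewrite (_ : G ^+ n = (G / q) ^+ n * q ^+ n); last first.
    by rewrite -exprMn divfK// gt_eqF.
  rewrite ler_wpM2r ?exprn_ge0 ?(ltW q0)// /C (bigD1 (Ordinal nN))//= addrCA.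
  by rewrite lerDl addr_ge0// sumr_ge0.
(* Length 0 is treated apart because undoing the root requires [n] nonzero. *)
have [->|n0] := posnP n.
  by rewrite /path_gain big_ord0 expr0 mulr1 /C lerDl sumr_ge0.
have n0' : n%:R != 0 :> R by rewrite pnatr_eq0 -lt0n.
have le_sup : path_gain j n <= sup_path_gain g n.
  apply: ub_le_sup; last by exists j.
  by exists (G ^+ n) => _ [j' _ <-]; exact: path_gain_le_exp.
have sup0 := le_trans (path_gain_ge0 j n) le_sup.
apply: (le_trans le_sup).
have -> : sup_path_gain g n = path_gain_root g n ^+ n.
  by rewrite /path_gain_root -powR_mulrn ?powR_ge0// -powRrM mulVf// powRr1.
apply: (@le_trans _ _ (q ^+ n)).
  by rewrite lerXn2r ?nnegrE ?powR_ge0 ?(ltW q0)// rootN.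
rewrite -{1}[q ^+ n]mul1r ler_wpM2r ?exprn_ge0 ?(ltW q0)// /C lerDl.
by rewrite sumr_ge0.
Qed.

(* The weight of i is the supremum of the gains of the paths issued from i,
   discounted by q per step; prepending an edge gives the contraction. *)
Lemma contracting_weight : Gamma_max_well_defined g ->
  cvgn (path_gain_root g) -> limn (path_gain_root g) < 1 ->
  exists q C (om : I -> R), [/\ 0 < q, q < 1,
    (forall i, 1 <= om i), (forall i, om i <= C) &
    forall i j, g i j * om j <= q * om i].
Proof.
move=> g_wd root_cvg root_lt1.
have [q [C [q0 q1 C0 gC]]] := path_gain_geometric g_wd root_cvg root_lt1.
pose E i := [set x | exists j n, j 0%N = i /\ path_gain j n / q ^+ n = x].
have EC i x : E i x -> x <= C.
  by move=> [j [n [_ <-]]]; rewrite ler_pdivrMr ?exprn_gt0.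
have Esup i x : E i x -> x <= sup (E i).
  by move=> Ex; apply: ub_le_sup Ex; exists C => y; exact: EC.
(* The empty path is what makes every weight at least 1. *)
have E1 i : E i 1.
  by exists (fun=> i), 0%N; rewrite /path_gain big_ord0 expr0 divr1.
exists q, C, (fun i => sup (E i)); split => //.
- by move=> i; exact: Esup.
- by move=> i; apply: ge_sup; [exists 1|exact: EC].
(* A zero gain is separated because the bound on the supremum is obtained by dividing by the
   gain. *)
move=> i k; have [->|gik] := eqVneq (g i k) 0.
  rewrite mul0r mulr_ge0 ?(ltW q0)//.
  by apply: le_trans (Esup _ _ (E1 i)).
have gik0 : 0 < g i k by rewrite lt_neqAle eq_sym gik g_ge0.
rewrite mulrC -ler_pdivlMr//; apply: ge_sup; first by exists 1.
move=> _ [j [n [j0 <-]]]; rewrite ler_pdivlMr//.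
rewrite mulrC -ler_pdivrMl//; apply: Esup.
exists (fun m => if m is m'.+1 then j m' else i), n.+1; split=> //.
rewrite /path_gain big_ord_recl /= j0 exprS invfM mulrACA mulrA.
by rewrite [g i k * _]mulrC -!mulrA.
Qed.

End gain_weight.

(** * Weighted trajectory estimates and ISS of the interconnection *)

Section small_gain.
Context {R : realType} {I : Type} {X : I -> normedModType R} {U : lmodType R}
  {V : input_space U} (S : forall i : I, subsystem X V i)
  (Sigma : control_system (linf_sum X) V).
Variables (beta : I -> R -> R -> R) (gam : I -> I -> R -> R) (gamu : I -> R -> R)
  (bmax : R -> R -> R) (gmax : R -> R) (g : I -> I -> R)
  (q : R) (om : I -> R).
Hypotheses (Sigma_flow : interconnection_flow S Sigma)
  (S_ISS : forall i, ISS_semimax (S i) (beta i) (gam i) (gamu i))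
  (bmax_KL : class_KL bmax) (gmax_K : class_K gmax)
  (beta_le : forall i r t, 0 <= r -> 0 <= t -> beta i r t <= bmax r t)
  (gamu_le : forall i r, 0 <= r -> gamu i r <= gmax r)
  (g_ge0 : forall i j, 0 <= g i j)
  (gam_linear : forall i j r, 0 <= r -> gam i j r = g i j * r)
  (q_gt0 : 0 < q) (q_lt1 : q < 1) (om_ge1 : forall i, 1 <= om i)
  (om_contract : forall i j, g i j * om j <= q * om i).

Let q1_gt0 : 0 < 1 - q. Proof. by rewrite subr_gt0. Qed.
Let om_ge0 i : 0 <= om i. Proof. exact: le_trans ler01 (om_ge1 i). Qed.

Lemma pdom_le (s t : {nonneg R}) x u :
  pdom Sigma t x u -> s%:num <= t%:num -> pdom Sigma s x u.
Proof.
move=> dt st; have [esc _ _ _ _] := flow_axioms Sigma.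
have [tm [_ tmP]] := esc x u.
by apply/tmP; apply: le_lt_trans (_ : _ <= t%:num%:E)%E _; [rewrite lee_fin|exact/tmP].
Qed.

(** The coupling term contracts by [om_contract]; the other two terms may be multiplied by [om i]
    because it is at least 1. *)
Lemma weighted_gain_step t x u (A : R) : pdom Sigma t x u -> 0 <= A ->
  (forall s : {nonneg R}, s%:num <= t%:num ->
     forall j, `|pval Sigma s x u j| <= A * om j) ->
  forall i, `|pval Sigma t x u i| <=
    (bmax `|x| t%:num + q * A + gmax `|u|) * om i.
Proof.
move=> dt A0 xA i; have [w [wE _ ->]] := Sigma_flow.2 t x u dt i.
have [_ _ _ _ est] := S_ISS i.
apply: (le_trans (est (x i) w u t)); rewrite !mulrDl.
have b0 : 0 <= bmax `|x| t%:num by exact: class_KL_ge0.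
have g0 : 0 <= gmax `|u| by exact: class_K_ge0.
apply: lerD; [apply: lerD|].
- apply: (@le_trans _ _ (bmax `|x| t%:num)); last by rewrite ler_peMr.
  apply: (le_trans (beta_le i (normr_ge0 _) _)) => //.
  by apply: class_KL_le => //; exact: linf_norm_ub.
- apply: ge_sup; first by exists 0; left.
  move=> _ [->|[j _ <-]]; first by rewrite !mulr_ge0// ltW.
  set n := sup_norm_on _ _.
  have wj s : s%:num <= t%:num -> `|w s j| <= A * om (sval j).
    by move=> st; have [_ ->] := wE s st; exact: xA.
  have nA : n <= A * om (sval j).
    apply: ge_sup; first by exists `|w t j|, t => /=.
    by move=> _ [s /= st <-]; exact: wj.
  (* Linearity of the gains is known only at nonnegative arguments. *)
  have n0 : 0 <= n.
    apply: le_trans (normr_ge0 (w t j)) _; apply: ub_le_sup.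
      by exists (A * om (sval j)) => _ [s /= st <-]; exact: wj.
    by exists t => /=.
  rewrite gam_linear//; apply: (le_trans (ler_wpM2l (g_ge0 _ _) nA)).
  by rewrite mulrCA [q * A]mulrC -mulrA ler_wpM2l.
- apply: (le_trans (gamu_le i (normr_ge0 _))).
  by rewrite ler_peMr.
Qed.

(** The norm of the trajectory is continuous, hence attains a maximum on the compact interval. This
    a priori bound starts the iterations below, where it acquires a factor [q ^+ n] and
    disappears. *)
Lemma trajectory_bounded t x u : pdom Sigma t x u -> exists2 A, 0 <= A &
  forall s : {nonneg R}, s%:num <= t%:num ->
    forall j, `|pval Sigma s x u j| <= A * om j.
Proof.
move=> dt; have [_ _ _ cont _] := flow_axioms Sigma.
pose f (s : R) := `|extend (fun s => pval Sigma s x u) s|.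
have cf : {within `[0, t%:num], continuous f}.
  apply: continuous_in_subspaceT => s; rewrite inE /= in_itv /= => /andP[s0 st].
  have ds := cont _ x u (@pdom_le (NngNum s0) t x u dt st).
  exact: cvg_norm ds.
have [c _ fc] := EVT_max (ge0 t) cf.
exists (f c); first exact: normr_ge0.
move=> s st j; apply: (@le_trans _ _ (f c)); last by rewrite ler_peMr// normr_ge0.
have := fc s%:num; rewrite in_itv /= ge0 st => /(_ isT).
rewrite /f /extend (_ : nneg_part s%:num = s).
  by apply: le_trans; exact: linf_norm_ub.
by apply: val_inj; rewrite /= max_l.
Qed.

Lemma le_of_geometric (a A K w : R) :
  (forall n, a <= (q ^+ n * A + K) * w) -> a <= K * w.
Proof.
move=> h; have : (q ^+ n * A + K) * w @[n --> \oo] --> (0 * A + K) * w.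
  apply: cvgMr_tmp; apply: cvgD; last exact: cvg_cst.
  by apply: cvgMr_tmp; apply: cvg_expr; rewrite ger0_norm// ltW.
rewrite mul0r add0r => /cvgr_to_ge; apply; exact: nearW.
Qed.

(** With [c] the sum of the two outer terms at time 0, [c / (1 - q)] is the fixed point of [A]
    mapped to [c + q * A]; iterating [weighted_gain_step] approaches it geometrically. *)
Lemma weighted_uniform_bound t x u : pdom Sigma t x u ->
  forall j, `|pval Sigma t x u j| <= (bmax `|x| 0 + gmax `|u|) / (1 - q) * om j.
Proof.
move=> dt; have [A A0 xA] := trajectory_bounded dt.
set c := bmax _ _ + _.
have c0 : 0 <= c by rewrite addr_ge0 ?(class_K_ge0 gmax_K) ?(class_KL_ge0 bmax_KL).
suff h n (s : {nonneg R}) : s%:num <= t%:num -> forall j,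
    `|pval Sigma s x u j| <= (q ^+ n * A + c / (1 - q)) * om j.
  by move=> j; apply: (@le_of_geometric _ A) => n; exact: h.
elim: n s => [|n IHn] s st j.
  rewrite expr0 mul1r; apply: le_trans (xA s st j) _.
  by rewrite ler_wpM2r// lerDl divr_ge0// ltW.
have K0 : 0 <= q ^+ n * A + c / (1 - q).
  by rewrite addr_ge0// ?mulr_ge0 ?exprn_ge0 ?invr_ge0// ltW.
apply: le_trans (weighted_gain_step (pdom_le dt st) K0 _ j) _.
  by move=> r rs; apply: IHn; exact: le_trans rs st.
rewrite ler_wpM2r//.
have : bmax `|x| s%:num <= bmax `|x| 0 by exact: class_KL_le_time.
rewrite -(lerD2r (gmax `|u|)) -/c addrAC -(lerD2r (q * (q ^+ n * A + c / (1 - q)))).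
move=> /le_trans; apply; rewrite le_eqVlt; apply/orP; left; apply/eqP.
by rewrite exprS; field; rewrite gt_eqF.
Qed.

(** One restart at half time corresponds to splitting off the first term and shifting the index. *)
Lemma halving_partial_rec s t n :
  series (halving_term q bmax s t) n.+1 =
    bmax s (t / 2) + q * series (halving_term q bmax s (t / 2)) n.
Proof.
rewrite /series /= big_ltn// {1}/halving_term expr0 mul1r expr1; congr +%R.
rewrite big_add1 /= mulr_sumr; apply: eq_bigr => k _.
by rewrite /halving_term exprS -!mulrA [2 ^+ k.+2]exprS invfM.
Qed.

(* Restarting the trajectory at t / 2 gives
   v(t) <= bmax B (t / 2) + q sup_[t / 2, t] v + gmax |u|,
   and iterating this bound produces the halving sum. *)
Lemma weighted_decay t x u (B : R) : pdom Sigma t x u ->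
  (forall s : {nonneg R}, s%:num <= t%:num -> `|pval Sigma s x u| <= B) ->
  forall j, `|pval Sigma t x u j| <=
    (halving_sum q bmax B t%:num + gmax `|u| / (1 - q)) * om j.
Proof.
move=> dt xB; have [A A0 xA] := trajectory_bounded dt.
have B0 : 0 <= B by apply: le_trans (xB t (lexx _)).
have [_ _ _ _ cocycle] := flow_axioms Sigma.
set c := gmax _ / _.
have gu0 : 0 <= gmax `|u| by exact: class_K_ge0.
have c0 : 0 <= c by rewrite divr_ge0// ltW.
have F0 n r : 0 <= r -> 0 <= series (halving_term q bmax B r) n.
  by move=> r0; apply: sumr_ge0 => k _; exact: halving_term_ge0.
have FM n r r' : 0 <= r -> r <= r' ->
    series (halving_term q bmax B r') n <= series (halving_term q bmax B r) n.
  move=> r0 rr'; apply: ler_sum => k _.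
  exact: (class_KL_le_time (halving_term_KL q_gt0 bmax_KL k)).
suff h n (s : {nonneg R}) : s%:num <= t%:num -> forall j, `|pval Sigma s x u j| <=
    (q ^+ n * A + (series (halving_term q bmax B s%:num) n + c)) * om j.
  move=> j; apply: (@le_of_geometric _ A) => n; apply: le_trans (h n t (lexx _) j) _.
  by rewrite ler_wpM2r// lerD2l lerD2r halving_partial_le.
elim: n s => [|n IHn] s st j.
  rewrite expr0 mul1r; apply: le_trans (xA s st j) _.
  by rewrite ler_wpM2r// lerDl addr_ge0// F0.
have h0 : 0 <= s%:num / 2 by rewrite divr_ge0.
pose h := NngNum h0.
have hh : h%:num + h%:num = s%:num by rewrite /=; lra.
(* By the cocycle property, the restarted trajectory on [[0, h]] is the original one on [[h, s]]. *)
have restart (r : {nonneg R}) : r%:num <= h%:num ->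
    pdom Sigma r (pval Sigma h x u) (input_shift h u) /\
    pval Sigma r (pval Sigma h x u) (input_shift h u) = pval Sigma (tadd h r) x u.
  move=> rh; apply: cocycle => p pr; apply: (pdom_le dt); apply: le_trans pr _.
  by apply: le_trans st; rewrite -hh lerD2l.
have [dh hE] := restart h (lexx _).
have -> : s = tadd h h by apply: val_inj; rewrite /= -[LHS]hh.
rewrite -hE.
(* The partial sum decreases in time, so the induction hypothesis at the left end [h] bounds all of
   [[h, s]]. *)
pose A' := q ^+ n * A + (series (halving_term q bmax B h%:num) n + c).
have A'0 : 0 <= A'.
  by rewrite addr_ge0 ?addr_ge0 ?F0// mulr_ge0// exprn_ge0// ltW.
apply: le_trans (weighted_gain_step dh A'0 _ j) _.
  move=> r rh k; have [_ ->] := restart r rh.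
  have hr : (tadd h r)%:num <= t%:num by apply: le_trans st; rewrite -hh lerD2l.
  apply: le_trans (IHn _ hr k) _.
  by rewrite ler_wpM2r// lerD2l lerD2r FM// lerDl.
rewrite ler_wpM2r// halving_partial_rec.
have -> : (tadd h h)%:num / 2 = h%:num by rewrite [(tadd h h)%:num]hh.
have h1 : bmax `|pval Sigma h x u| h%:num <= bmax B h%:num.
  by apply: class_KL_le => //; apply: xB; apply: le_trans st; rewrite -hh lerDl.
have h2 : gmax `|input_shift h u| <= gmax `|u|.
  by apply: class_K_le => //; exact: input_norm_shift.
apply: le_trans (lerD (lerD h1 (lexx _)) h2) _.
rewrite le_eqVlt; apply/orP; left; apply/eqP; rewrite /A' /c exprS; field.
by rewrite gt_eqF.
Qed.

Lemma ISS_of_weighted_gains (C : R) : inhabited I -> (forall i, om i <= C) ->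
  ISS Sigma.
Proof.
move=> [i0] omC; have C1 : 1 <= C := le_trans (om_ge1 i0) (omC i0).
have C0 : 0 < C := lt_le_trans ltr01 C1.
have K0 : 0 < 2 * C / (1 - q) by rewrite divr_gt0// mulr_gt0.
(* The factor 2 merges the two summands of the uniform bound once the input term is the smaller one;
   [C] converts the weighted norm to the plain one. *)
pose kappa s := 2 * C / (1 - q) * bmax s 0.
have kappa_K : class_K kappa.
  by apply: class_K_scale => //; have [_ bK _] := bmax_KL; exact: bK.
exists (fun s t => C * halving_sum q bmax (kappa s) t),
  (fun r => 2 * C / (1 - q) * gmax r).
have hs_KL := halving_sum_KL q_gt0 q_lt1 bmax_KL.
split; [|by left; exact: class_K_scale|].
  exact/class_KL_scale/(class_KL_comp kappa_K).
have norm_le t x u K : 0 <= K ->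
    (forall j, `|pval Sigma t x u j| <= K * om j) -> `|pval Sigma t x u| <= K * C.
  move=> K_ge0 h; apply: linf_norm_le => [|j]; first by rewrite mulr_ge0// ltW.
  by apply: le_trans (h j) _; rewrite ler_wpM2l.
move=> t x u dt.
have bx0 : 0 <= bmax `|x| 0 by exact: class_KL_ge0.
have gu0 : 0 <= gmax `|u| by exact: class_K_ge0.
have kx0 : 0 <= kappa `|x| by exact: class_K_ge0.
have hs0 : 0 <= halving_sum q bmax (kappa `|x|) t%:num by exact: class_KL_ge0.
have q1_0 : 0 <= (1 - q)^-1 by rewrite invr_ge0 ltW.
have ub s : pdom Sigma s x u ->
    `|pval Sigma s x u| <= (bmax `|x| 0 + gmax `|u|) / (1 - q) * C.
  move=> ds; apply: norm_le; last exact: weighted_uniform_bound.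
  by rewrite mulr_ge0// addr_ge0.
(* The case distinction keeps the input out of the first argument of the KL function. *)
have [gb|bg] := leP (gmax `|u|) (bmax `|x| 0).
  apply: le_trans (norm_le _ _ _ _ _ (weighted_decay (B := kappa `|x|) dt _)) _.
  - by rewrite addr_ge0// mulr_ge0.
  - move=> s st; apply: le_trans (ub s (pdom_le dt st)) _.
    rewrite /kappa; have -> : 2 * C / (1 - q) * bmax `|x| 0 =
      (2 * bmax `|x| 0) / (1 - q) * C by field; rewrite gt_eqF.
    by rewrite ler_wpM2r ?(ltW C0)// ler_wpM2r// mulr2n mulrDl mul1r lerD2l.
  - rewrite mulrDl [halving_sum _ _ _ _ * C]mulrC lerD2l.
    have -> : gmax `|u| / (1 - q) * C = C / (1 - q) * gmax `|u| by field; rewrite gt_eqF.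
    by rewrite ler_wpM2r// ler_wpM2r// ler_peMl ?(ltW C0)// ler1n.
(* For a dominant input the gain term alone covers the uniform bound, and the KL term only has to be
   nonnegative. *)
apply: le_trans (ub t dt) _; rewrite -[leLHS]add0r lerD//.
  by rewrite mulr_ge0// ltW.
have -> : 2 * C / (1 - q) * gmax `|u| =
  (2 * gmax `|u|) / (1 - q) * C by field; rewrite gt_eqF.
rewrite ler_wpM2r ?(ltW C0)// ler_wpM2r// mulr2n mulrDl mul1r lerD2r.
exact: ltW.
Qed.

End small_gain.

Theorem corollary6p3 (R : realType) (I : Type) (I_nonempty : inhabited I)
    (X : I -> normedModType R) (U : lmodType R) (V : input_space U)
    (S : forall i : I, subsystem X V i)
    (S_complete : forall i : I, forward_complete (S i))
    (Sigma : control_system (linf_sum X) V)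
    (Sigma_interconnection : is_interconnection S Sigma)
    (beta : I -> R -> R -> R) (gam : I -> I -> R -> R) (gamu : I -> R -> R)
    (S_ISS : forall i : I, ISS_semimax (S i) (beta i) (gam i) (gamu i))
    (beta_max : R -> R -> R) (gamu_max : R -> R)
    (beta_max_KL : class_KL beta_max) (gamu_max_K : class_K gamu_max)
    (beta_le : forall (i : I) (r t : R), 0 <= r -> 0 <= t ->
       beta i r t <= beta_max r t)
    (gamu_le : forall (i : I) (r : R), 0 <= r -> gamu i r <= gamu_max r)
    (g : I -> I -> R)
    (g_ge0 : forall i j : I, 0 <= g i j)
    (gam_linear : forall (i j : I) (r : R), 0 <= r -> gam i j r = g i j * r)
    (g_well_defined : Gamma_max_well_defined g)
    (root_cvg : cvgn (path_gain_root g))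
    (root_lt1 : limn (path_gain_root g) < 1) :
  ISS Sigma.
Proof.
have [q [C [om [q_gt0 q_lt1 om_ge1 om_le om_contract]]]] :=
  contracting_weight g_ge0 g_well_defined root_cvg root_lt1.
have [[Sigma_flow _] _ _] := Sigma_interconnection.
exact: (ISS_of_weighted_gains Sigma_flow S_ISS beta_max_KL gamu_max_K beta_le
  gamu_le g_ge0 gam_linear q_gt0 q_lt1 om_ge1 om_contract I_nonempty om_le).
Qed.
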